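(* Let $A$ be a simple, unital, purely infinite $C^*$-algebra such that $K_1(A)$ is the trivial group. Let $n \ge 2$ and $i \neq j$ with $1 \le i,j \le n$. If $u \in \mathcal{U}(A)$, then $[P_{i,j}(u)] = [1]$ in $K_0(A)$.
   Context: $\mathcal{U}(A)$ is the unitary group of $A$. For $a \in A$, $P_{i,j}(a) \in \mathbb{M}_n(A) \cong A \otimes \mathbb{M}_n(\mathbb{C})$ is the projection $$P_{i,j}(a) = (1+aa^* )^{-1}\otimes E_{i,i} + (1+aa^* )^{-1}a \otimes E_{i,j} + a^*(1+aa^* )^{-1}\otimes E_{j,i} + a^*(1+aa^* )^{-1}a \otimes E_{j,j},$$ where $E_{k,l}$ are the standard matrix units of $\mathbb{M}_n(\mathbb{C})$. Classes of projections of $\mathbb{M}_n(A)$ are taken in $K_0(A)$, and $[1]$ is the class of the unit $1$ of $A$. *)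

(* Defs.v *)
From HB Require Import structures.
From mathcomp Require Import all_boot all_order all_algebra.
From mathcomp Require Import generic_quotient complex lra.
From mathcomp Require Import all_classical all_reals all_analysis.

Set Implicit Arguments.
Unset Strict Implicit.
Unset Printing Implicit Defensive.

Import Order.TTheory GRing.Theory Num.Theory.
Import numFieldNormedType.Exports.

Local Open Scope classical_set_scope.
Local Open Scope ring_scope.
Local Open Scope complex_scope.
Local Open Scope quotient_scope.

(* Unital C*-algebras over the complex numbers R[i]. The multiplication is     *)
(* part of the mixin, and the ring structures are only derived from it below:  *)
(* the hierarchy has no structure joining normed modules and noncommutative    *)
(* rings.                                                                      *)
HB.mixin Record isCStarAlgebra (R : realType) (A : Type)
    & CompleteNormedModule R[i] A := {
  cstar_one : A;
  cstar_mul : A -> A -> A;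
  star : A -> A;
  cstar_mulA : associative cstar_mul;
  cstar_mul1x : left_id cstar_one cstar_mul;
  cstar_mulx1 : right_id cstar_one cstar_mul;
  cstar_mulDl : left_distributive cstar_mul +%R;
  cstar_mulDr : right_distributive cstar_mul +%R;
  cstar_one_neq0 : cstar_one != 0;
  cstar_scaleAl : forall (c : R[i]) (x y : A),
    c *: cstar_mul x y = cstar_mul (c *: x) y;
  cstar_scaleAr : forall (c : R[i]) (x y : A),
    c *: cstar_mul x y = cstar_mul x (c *: y);
  starD : forall x y : A, star (x + y) = star x + star y;
  starZ : forall (c : R[i]) (x : A), star (c *: x) = c^* *: star x;
  cstar_starM : forall x y : A,
    star (cstar_mul x y) = cstar_mul (star y) (star x);
  starK : involutive star;
  cstar_normM : forall x y : A, `|cstar_mul x y| <= `|x| * `|y|;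
  cstar_norm_star : forall x : A, `|cstar_mul (star x) x| = `|x| ^+ 2
}.

#[short(type="cstarAlgType")]
HB.structure Definition CStarAlgebra (R : realType) :=
  {A of isCStarAlgebra R A & CompleteNormedModule R[i] A}.

Section CStarRing.
Variables (R : realType) (A : cstarAlgType R).

#[non_forgetful_inheritance]
HB.instance Definition _ := GRing.Zmodule_isNzRing.Build A
  (@cstar_mulA R A) (@cstar_mul1x R A) (@cstar_mulx1 R A)
  (@cstar_mulDl R A) (@cstar_mulDr R A) (@cstar_one_neq0 R A).
#[non_forgetful_inheritance]
HB.instance Definition _ := GRing.Lmodule_isLalgebra.Build R[i] A
  (@cstar_scaleAl R A).
#[non_forgetful_inheritance]
HB.instance Definition _ := GRing.Lalgebra_isAlgebra.Build R[i] A
  (@cstar_scaleAr R A).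

Definition cstar_inverses (x : A) : set A := [set y | y * x = 1 /\ x * y = 1].
Definition cstar_unit : pred A := fun x => `[< exists y, cstar_inverses x y >].
Definition cstar_inv (x : A) : A := xget x (cstar_inverses x).

Fact cstar_mulVr : {in cstar_unit, left_inverse 1 cstar_inv *%R}.
Proof.
by move=> x /asboolP[y xy]; rewrite /cstar_inv; case: xgetP => [z _ []|/(_ y)].
Qed.

Fact cstar_mulrV : {in cstar_unit, right_inverse 1 cstar_inv *%R}.
Proof.
by move=> x /asboolP[y xy]; rewrite /cstar_inv; case: xgetP => [z _ []|/(_ y)].
Qed.

Fact cstar_unitP (x y : A) : y * x = 1 /\ x * y = 1 -> cstar_unit x.
Proof. by move=> xy; apply/asboolP; exists y. Qed.

Fact cstar_inv_out : {in [predC cstar_unit], cstar_inv =1 id}.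
Proof.
move=> x /asboolPn nx; rewrite /cstar_inv; case: xgetP => // y _ xy.
by case: nx; exists y.
Qed.

#[non_forgetful_inheritance]
HB.instance Definition _ := GRing.NzRing_hasMulInverse.Build A
  cstar_mulVr cstar_mulrV cstar_unitP cstar_inv_out.

Lemma starM (x y : A) : star (x * y) = star y * star x.
Proof. exact: cstar_starM. Qed.

Lemma star0 : star (0 : A) = 0.
Proof. by apply: (addrI (star 0)); rewrite -starD !addr0. Qed.

Lemma star1 : star (1 : A) = 1.
Proof. by rewrite -[LHS]mulr1 -[X in _ * X](starK 1) -starM mulr1 starK. Qed.

Lemma star_sum I (r : seq I) (P : pred I) (F : I -> A) :
  star (\sum_(i <- r | P i) F i) = \sum_(i <- r | P i) star (F i).
Proof. exact: (big_morph _ starD star0). Qed.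

Lemma starV (x : A) : x \is a GRing.unit -> star x^-1 = (star x)^-1.
Proof.
move=> ux; have e1 : star x^-1 * star x = 1 by rewrite -starM divrr // star1.
have e2 : star x * star x^-1 = 1 by rewrite -starM mulVr // star1.
have us : star x \is a GRing.unit by apply/unitrP; exists (star x^-1).
by apply: (mulrI us); rewrite e2 divrr.
Qed.

End CStarRing.

Section Notions.
Variables (R : realType) (A : cstarAlgType R).

Definition unitary (u : A) : Prop := star u * u = 1 /\ u * star u = 1.

Definition projection (p : A) : Prop := star p = p /\ p * p = p.

(* Positive elements as the x = y^* y, and the order they induce.              *)
Definition cstar_pos (x : A) : Prop := exists y, x = star y * y.

Definition cstar_le (x y : A) : Prop := cstar_pos (y - x).

Definition infinite_projection (p : A) : Prop :=
  projection p /\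
  exists q, [/\ projection q, cstar_le q p, q <> p &
    exists v : A, star v * v = p /\ v * star v = q].

(* A norm-closed *-subalgebra, not necessarily containing 1.                   *)
Definition cstar_subalgebra (B : set A) : Prop :=
  [/\ closed B, B 0, (forall x y, B x -> B y -> B (x + y)) &
    [/\ (forall (c : R[i]) x, B x -> B (c *: x)),
        (forall x y, B x -> B y -> B (x * y)) &
        (forall x, B x -> B (star x))]].

Definition hereditary_subalgebra (B : set A) : Prop :=
  cstar_subalgebra B /\
  forall a b, cstar_pos a -> cstar_le a b -> B b -> B a.

(* Cuntz's definition, used for simple A only: every nonzero hereditary        *)
(* C*-subalgebra contains an infinite projection.                              *)
Definition purely_infinite : Prop :=
  forall B : set A, hereditary_subalgebra B -> B <> [set 0] ->
    exists2 p, B p & infinite_projection p.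

Definition closed_ideal (I : set A) : Prop :=
  [/\ closed I, I 0, (forall x y, I x -> I y -> I (x + y)) &
    forall a x, I x -> I (a * x) /\ I (x * a)].

Definition cstar_simple : Prop :=
  forall I : set A, closed_ideal I -> I = [set 0] \/ I = setT.

End Notions.

Arguments purely_infinite {R} A.
Arguments cstar_simple {R} A.

Section MatrixAdjoint.
Variables (R : realType) (A : cstarAlgType R).

Definition madj m n (M : 'M[A]_(m, n)) : 'M[A]_(n, m) :=
  \matrix_(i, j) star (M j i).

Lemma madjK m n (M : 'M[A]_(m, n)) : madj (madj M) = M.
Proof. by apply/matrixP => i j; rewrite !mxE starK. Qed.

Lemma madjM m n p (M : 'M[A]_(m, n)) (N : 'M[A]_(n, p)) :
  madj (M *m N) = madj N *m madj M.
Proof.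
apply/matrixP => i j; rewrite !mxE star_sum; apply: eq_bigr => k _.
by rewrite !mxE starM.
Qed.

Lemma madj0 m n : madj (0 : 'M[A]_(m, n)) = 0.
Proof. by apply/matrixP => i j; rewrite !mxE star0. Qed.

Lemma madj1 n : madj (1%:M : 'M[A]_n) = 1%:M.
Proof.
apply/matrixP => i j; rewrite !mxE eq_sym.
by case: eqP; rewrite (star0, star1).
Qed.

Lemma madj_block m1 m2 n1 n2 (a : 'M[A]_(m1, n1)) (b : 'M[A]_(m1, n2))
    (c : 'M[A]_(m2, n1)) (d : 'M[A]_(m2, n2)) :
  madj (block_mx a b c d) = block_mx (madj a) (madj c) (madj b) (madj d).
Proof.
apply/matrixP => i j.
rewrite -(splitK i) -(splitK j); case: (fintype.split i) => i'; case: (fintype.split j) => j' /=.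
- by rewrite mxE !block_mxEul mxE.
- by rewrite mxE block_mxEdl block_mxEur mxE.
- by rewrite mxE block_mxEdl block_mxEur mxE.
- by rewrite mxE !block_mxEdr mxE.
Qed.

Lemma madj_row m n1 n2 (a : 'M[A]_(m, n1)) (b : 'M[A]_(m, n2)) :
  madj (row_mx a b) = col_mx (madj a) (madj b).
Proof.
apply/matrixP => i j; rewrite -(splitK i); case: (fintype.split i) => i' /=.
- by rewrite mxE row_mxEl col_mxEu mxE.
- by rewrite mxE row_mxEr col_mxEd mxE.
Qed.

End MatrixAdjoint.

Section Projectors.
Variables (R : realType) (A : cstarAlgType R).

Definition is_proj_mx n (p : 'M[A]_n) : bool :=
  (madj p == p) && (p *m p == p).

Record projector n := Projector {proj_mx : 'M[A]_n; _ : is_proj_mx proj_mx}.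

HB.instance Definition _ n := [isSub for @proj_mx n].
HB.instance Definition _ n := [Choice of projector n by <:].

Lemma proj_mx_adj n (p : projector n) : madj (proj_mx p) = proj_mx p.
Proof. by case: p => p /= /andP[/eqP]. Qed.

Lemma proj_mx_idem n (p : projector n) :
  proj_mx p *m proj_mx p = proj_mx p.
Proof. by case: p => p /= /andP[_ /eqP]. Qed.

Fact is_proj_mx1 n : is_proj_mx (1%:M : 'M[A]_n).
Proof. by rewrite /is_proj_mx madj1 mulmx1 !eqxx. Qed.
Definition proj1 n : projector n := Projector (is_proj_mx1 n).

Fact is_proj_mx0 n : is_proj_mx (0 : 'M[A]_n).
Proof. by rewrite /is_proj_mx madj0 mulmx0 !eqxx. Qed.
Definition proj0 n : projector n := Projector (is_proj_mx0 n).

Fact is_proj_mx_block m n (p : projector m) (q : projector n) :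
  is_proj_mx (block_mx (proj_mx p) 0 0 (proj_mx q)).
Proof.
rewrite /is_proj_mx madj_block !proj_mx_adj !madj0 eqxx mulmx_block.
by rewrite !(mulmx0, mul0mx, addr0, add0r) !proj_mx_idem eqxx.
Qed.
Definition proj_sum m n (p : projector m) (q : projector n) :
  projector (m + n) := Projector (is_proj_mx_block p q).

(* Murray-von Neumann equivalence of projections over A of any two sizes. *)
Definition mvn_equiv m n (p : projector m) (q : projector n) : Prop :=
  exists v : 'M[A]_(n, m),
    madj v *m v = proj_mx p /\ v *m madj v = proj_mx q.

Lemma mvn_refl n (p : projector n) : mvn_equiv p p.
Proof. by exists (proj_mx p); rewrite proj_mx_adj proj_mx_idem. Qed.

Lemma mvn_sym m n (p : projector m) (q : projector n) :
  mvn_equiv p q -> mvn_equiv q p.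
Proof. by move=> [v [vp vq]]; exists (madj v); rewrite madjK. Qed.

Lemma mvn_trans m n k (p : projector m) (q : projector n) (r : projector k) :
  mvn_equiv p q -> mvn_equiv q r -> mvn_equiv p r.
Proof.
move=> [v [vp vq]] [w [wq wr]]; exists (w *m v); rewrite madjM; split.
  rewrite mulmxA -(mulmxA (madj v)) wq -vq -!mulmxA vp mulmxA vp.
  exact: proj_mx_idem.
rewrite mulmxA -(mulmxA w) vq -wq -!mulmxA wr mulmxA wr.
exact: proj_mx_idem.
Qed.

Lemma mvn_sum m n m' n' (p : projector m) (q : projector n)
    (p' : projector m') (q' : projector n') :
  mvn_equiv p p' -> mvn_equiv q q' ->
  mvn_equiv (proj_sum p q) (proj_sum p' q').
Proof.
move=> [v [vp vp']] [w [wq wq']]; exists (block_mx v 0 0 w).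
rewrite madj_block !madj0 !mulmx_block.
by rewrite !(mulmx0, mul0mx, addr0, add0r) vp vp' wq wq'.
Qed.

Lemma mvn_sumC m n (p : projector m) (q : projector n) :
  mvn_equiv (proj_sum p q) (proj_sum q p).
Proof.
exists (block_mx 0 (proj_mx q) (proj_mx p) 0).
rewrite madj_block !madj0 !mulmx_block !proj_mx_adj.
by rewrite !(mulmx0, mul0mx, addr0, add0r) !proj_mx_idem.
Qed.

Lemma mvn_cast m n (p : projector m) (q : projector n) (e : m = n) :
  castmx (e, e) (proj_mx p) = proj_mx q -> mvn_equiv p q.
Proof.
case: n / e q => q; rewrite castmx_id => /val_inj <-; exact: mvn_refl.
Qed.

Lemma mvn_sumA m n k (p : projector m) (q : projector n) (r : projector k) :
  mvn_equiv (proj_sum p (proj_sum q r)) (proj_sum (proj_sum p q) r).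
Proof.
apply/mvn_sym/(@mvn_cast _ _ _ _ (esym (addnA m n k))) => /=.
have := @block_mxA A m n k m n k (proj_mx p) 0 0 0 (proj_mx q) 0 0 0 (proj_mx r).
by rewrite /= !row_mx0 !col_mx0 => ->.
Qed.

Lemma mvn_sum0 n (p : projector n) : mvn_equiv (proj_sum (proj0 0) p) p.
Proof.
exists (row_mx 0 (proj_mx p)); rewrite madj_row madj0 proj_mx_adj; split.
  by rewrite mul_col_row !(mulmx0, mul0mx) proj_mx_idem.
by rewrite mul_row_col mulmx0 add0r proj_mx_idem.
Qed.

Definition proj_inf := {n : nat & projector n}.

Definition mvn_rel : rel proj_inf :=
  fun p q => `[< mvn_equiv (tagged p) (tagged q) >].

Fact mvn_rel_equiv : equiv_class_of mvn_rel.
Proof.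
split=> [p|p q|q p r].
- exact/asboolP/mvn_refl.
- by apply/asboolP/asboolP; apply: mvn_sym.
- by move=> /asboolP pq /asboolP qr; apply/asboolP/(mvn_trans pq qr).
Qed.

Canonical mvn_equiv_rel := EquivRelPack mvn_rel_equiv.

End Projectors.

Arguments proj1 {R} A n.
Arguments proj0 {R} A n.

(* The semigroup V(A) of Murray-von Neumann classes of projections in matrix   *)
(* algebras over A, with [p] + [q] = [diag(p, q)].                             *)
Definition mvn_semigroup (R : realType) (A : cstarAlgType R) :=
  {eq_quot @mvn_rel R A}.

Section MvNSemigroup.
Variables (R : realType) (A : cstarAlgType R).
Local Notation V := (mvn_semigroup A).

HB.instance Definition _ := Choice.on V.
HB.instance Definition _ := EqQuotient.on V.

Definition mvn_class n (p : projector A n) : V :=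
  \pi_V (Tagged (@projector R A) p).

Lemma mvn_classP m n (p : projector A m) (q : projector A n) :
  mvn_class p = mvn_class q <-> mvn_equiv p q.
Proof. by split=> [/eqmodP/asboolP|pq]; last exact/eqmodP/asboolP. Qed.

Lemma mvn_classE (x : V) : x = mvn_class (tagged (repr x)).
Proof. by rewrite /mvn_class -[LHS]reprK; case: (repr x). Qed.

Definition mvn_add (x y : V) : V :=
  mvn_class (proj_sum (tagged (repr x)) (tagged (repr y))).

Lemma mvn_addE m n (p : projector A m) (q : projector A n) :
  mvn_add (mvn_class p) (mvn_class q) = mvn_class (proj_sum p q).
Proof. by apply/mvn_classP/mvn_sum; apply/mvn_classP; rewrite -mvn_classE. Qed.

Fact mvn_addA : associative mvn_add.
Proof.
move=> x y z; rewrite (mvn_classE x) (mvn_classE y) (mvn_classE z) !mvn_addE.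
exact/mvn_classP/mvn_sumA.
Qed.

Fact mvn_addC : commutative mvn_add.
Proof. by move=> x y; apply/mvn_classP/mvn_sumC. Qed.

Fact mvn_add0 : left_id (mvn_class (proj0 A 0)) mvn_add.
Proof.
by move=> x; rewrite (mvn_classE x) mvn_addE; apply/mvn_classP/mvn_sum0.
Qed.

HB.instance Definition _ :=
  GRing.isNmodule.Build V mvn_addA mvn_addC mvn_add0.

End MvNSemigroup.

Section GrothendieckRel.
Variable M : nmodType.

Definition groth_rel : rel (M * M) :=
  fun x y => `[< exists z, x.1 + y.2 + z = y.1 + x.2 + z >].

Fact groth_rel_equiv : equiv_class_of groth_rel.
Proof.
split=> [x|x y|y x w].
- by apply/asboolP; exists 0.
- by apply/asboolP/asboolP => -[z e]; exists z.
- move=> /asboolP[z e] /asboolP[z' e']; apply/asboolP.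
  exists (z + z' + y.1 + y.2).
  rewrite (_ : _ + _ = (x.1 + y.2 + z) + (y.1 + w.2 + z')); last first.
    by rewrite !addrA [in RHS](ACl (1*5*3*6*4*2)).
  by rewrite e e' !addrA [in LHS](ACl (4*2*3*6*1*5)).
Qed.

Canonical groth_equiv_rel := EquivRelPack groth_rel_equiv.

End GrothendieckRel.

(* Grothendieck group of a commutative monoid: the class of (a, b) stands for  *)
(* the formal difference a - b.                                                *)
Definition grothendieck (M : nmodType) := {eq_quot @groth_rel M}.

Section Grothendieck.
Variable M : nmodType.
Local Notation G := (grothendieck M).

HB.instance Definition _ := Choice.on G.
HB.instance Definition _ := EqQuotient.on G.

Definition gdiff (a b : M) : G := \pi_G (a, b).

Lemma gdiffP a b c d :
  gdiff a b = gdiff c d <-> exists z, a + d + z = c + b + z.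
Proof. by split=> [/eqmodP/asboolP|pq]; last exact/eqmodP/asboolP. Qed.

Lemma gdiffE (x : G) : x = gdiff (repr x).1 (repr x).2.
Proof. by rewrite /gdiff -[LHS]reprK; case: (repr x). Qed.

Definition gadd (x y : G) : G :=
  gdiff ((repr x).1 + (repr y).1) ((repr x).2 + (repr y).2).
Definition gopp (x : G) : G := gdiff (repr x).2 (repr x).1.

Lemma gaddE a b c d : gadd (gdiff a b) (gdiff c d) = gdiff (a + c) (b + d).
Proof.
have /gdiffP[z e] := esym (gdiffE (gdiff a b)).
have /gdiffP[z' e'] := esym (gdiffE (gdiff c d)).
apply/gdiffP; exists (z + z').
move: e e'; set a' := (repr (gdiff a b)).1; set b' := (repr (gdiff a b)).2.
set c' := (repr (gdiff c d)).1; set d' := (repr (gdiff c d)).2 => e e'.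
rewrite (_ : _ + _ = (a' + b + z) + (c' + d + z')); last first.
  by rewrite !addrA [in RHS](ACl (1*4*2*5*3*6)).
by rewrite e e' !addrA [in LHS](ACl (1*4*2*5*3*6)).
Qed.

Lemma goppE a b : gopp (gdiff a b) = gdiff b a.
Proof.
have /gdiffP[z e] := esym (gdiffE (gdiff a b)).
by apply/gdiffP; exists z; rewrite (addrC _ a) -e (addrC b).
Qed.

Fact gaddA : associative gadd.
Proof.
by move=> x y z; rewrite (gdiffE x) (gdiffE y) (gdiffE z) !gaddE !addrA.
Qed.

Fact gaddC : commutative gadd.
Proof.
by move=> x y; rewrite (gdiffE x) (gdiffE y) !gaddE addrC [in X in gdiff _ X]addrC.
Qed.

Fact gadd0 : left_id (gdiff 0 0) gadd.
Proof. by move=> x; rewrite (gdiffE x) gaddE !add0r. Qed.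

Fact gaddN : left_inverse (gdiff 0 0) gopp gadd.
Proof.
move=> x; rewrite (gdiffE x) goppE gaddE; apply/gdiffP; exists 0.
by rewrite !addr0 add0r addrC.
Qed.

HB.instance Definition _ := GRing.isZmodule.Build G gaddA gaddC gadd0 gaddN.

End Grothendieck.

(* K_0 of a unital C*-algebra: the Grothendieck group of V(A).                 *)
Definition K0 (R : realType) (A : cstarAlgType R) : zmodType :=
  grothendieck (mvn_semigroup A).

Definition K0_class (R : realType) (A : cstarAlgType R) n
  (p : projector A n) : K0 A := gdiff (mvn_class p) 0.

Section Unitaries.
Variables (R : realType) (A : cstarAlgType R).

Definition is_unitary_mx n (u : 'M[A]_n) : bool :=
  (madj u *m u == 1%:M) && (u *m madj u == 1%:M).

Record unitary_mx n := UnitaryMx {umx : 'M[A]_n; _ : is_unitary_mx umx}.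

HB.instance Definition _ n := [isSub for @umx n].
HB.instance Definition _ n := [Choice of unitary_mx n by <:].

Lemma umxP n (u : unitary_mx n) : is_unitary_mx (umx u).
Proof. by case: u. Qed.

Fact is_unitary_mx1 n : is_unitary_mx (1%:M : 'M[A]_n).
Proof. by rewrite /is_unitary_mx madj1 mulmx1 eqxx. Qed.
Definition unitary1 n : unitary_mx n := UnitaryMx (is_unitary_mx1 n).

(* For n <= N, the matrix diag(u, 1). *)
Definition pad N n (u : 'M[A]_n) : 'M[A]_N :=
  \matrix_(i, j)
    match insub (i : nat), insub (j : nat) with
    | Some i', Some j' => u i' j'
    | _, _ => (i == j)%:R
    end.

Lemma padE n k (u : 'M[A]_n) : pad (n + k) u = block_mx u 0 0 1%:M.
Proof.
have insubr (a : 'I_k) : insub (n + a)%N = None :> option 'I_n.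
  by apply: insubN; rewrite -leqNgt leq_addr.
apply/matrixP => i j; rewrite -(splitK i) -(splitK j).
case: (fintype.split i) => i'; case: (fintype.split j) => j' /=; rewrite mxE /=.
- by rewrite block_mxEul !valK.
- by rewrite block_mxEur mxE valK insubr eq_lrshift.
- by rewrite block_mxEdl mxE insubr eq_rlshift.
- by rewrite block_mxEdr mxE insubr eq_rshift.
Qed.

Lemma pad_pad n N N' (u : 'M[A]_n) : (n <= N)%N -> (N <= N')%N ->
  pad N' (pad N u) = pad N' u.
Proof.
move=> nN NN'; apply/matrixP => i j; rewrite !mxE.
case: (insubP 'I_N (i : nat)) => [i' _ ii'|iN]; last first.
  by rewrite (insubN 'I_n) //; apply: contra iN => /leq_trans; apply.
case: (insubP 'I_N (j : nat)) => [j' _ jj'|jN]; last first.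
  have jn : ~~ (j < n)%N by apply: contra jN => /leq_trans; apply.
  by rewrite (insubN 'I_n jn); case: insub.
have e : (i' == j') = (i == j).
  by rewrite -(inj_eq (@ord_inj N)) -(inj_eq (@ord_inj N')) ii' jj'.
by rewrite mxE ii' jj' e.
Qed.

Lemma is_unitary_mx_pad n N (u : 'M[A]_n) : (n <= N)%N ->
  is_unitary_mx u -> is_unitary_mx (pad N u).
Proof.
move=> /subnKC <- /andP[/eqP u1 /eqP u2]; rewrite padE /is_unitary_mx.
rewrite madj_block !madj0 madj1 !mulmx_block !(mulmx0, mul0mx, addr0, add0r).
by rewrite u1 u2 mulmx1 -scalar_mx_block eqxx.
Qed.

(* The topology on n x n matrices is that of entrywise convergence, which is   *)
(* the topology of the C*-norm of M_n(A).                                      *)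
Definition unitary_homotopic n (u v : 'M[A]_n) : Prop :=
  exists f : R -> 'M[A]_n,
    [/\ {within `[0, 1], continuous f},
        (forall t, t \in `[0, 1] -> is_unitary_mx (f t)), f 0 = u & f 1 = v].

Lemma unitary_homotopic_refl n (u : 'M[A]_n) :
  is_unitary_mx u -> unitary_homotopic u u.
Proof. by move=> uu; exists (cst u); split=> // ?; exact: cst_continuous. Qed.

Lemma within_affine_comp n (f : R -> 'M[A]_n) (a b c d : R) :
  {within `[0, 1], continuous f} ->
  (forall t, t \in `[a, b] -> c * t + d \in `[0, 1]) ->
  {within `[a, b], continuous (fun t => f (c * t + d))}.
Proof.
move=> /subspace_continuousP cf ab; apply/subspace_continuousP => x /= xab.
have cg : (fun t : R => c * t + d) @ x --> c * x + d.
  apply: cvgD; last exact: cvg_cst.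
  by apply: cvgM; [exact: cvg_cst|exact: cvg_id].
apply: (@cvg_trans _ (f @ within `[0, 1]%classic (nbhs (c * x + d)))); last first.
  exact/cf/ab.
move=> W /= fW; have {}fW := cg _ fW; rewrite /= in fW.
by apply: (@filterS _ (nbhs x) _ _ _ _ fW) => t /= tW tab; exact/tW/ab.
Qed.

Lemma unitary_homotopic_sym n (u v : 'M[A]_n) :
  unitary_homotopic u v -> unitary_homotopic v u.
Proof.
move=> [f [cf uf f0 f1]]; exists (fun t => f (-1 * t + 1)); split.
- apply: within_affine_comp cf _ => t; rewrite !in_itv /=; lra.
- by move=> t t01; apply: uf; move: t01; rewrite !in_itv /=; lra.
- by rewrite mulr0 add0r.
- by rewrite mulr1 addNr.
Qed.

Lemma unitary_homotopic_trans n (u v w : 'M[A]_n) :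
  unitary_homotopic u v -> unitary_homotopic v w -> unitary_homotopic u w.
Proof.
move=> [f [cf uf f0 f1]] [g [cg ug g0 g1]].
pose h (t : R) := if t <= 2^-1 then f (2 * t + 0) else g (2 * t + -1).
have hf t : t \in `[0, 2^-1] -> h t = f (2 * t + 0).
  by rewrite in_itv /h /= => /andP[_ ->].
have hg t : t \in `[2^-1, 1] -> h t = g (2 * t + -1).
  rewrite in_itv /h /= => /andP[t0 t1]; case: ifPn => // t2.
  have -> : t = 2^-1 by apply/eqP; rewrite eq_le t2.
  by rewrite divff // subrr addr0 f1 g0.
exists h; split.
- have -> : `[0, 1]%classic = `[0, 2^-1]%classic `|` `[2^-1, 1]%classic :> set R.
    by rewrite predeqE => t /=; rewrite !in_itv /=; split => [|[]]; lra.
  apply: withinU_continuous; [exact: itv_closed|exact: itv_closed| |].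
    apply: (subspace_eq_continuous (f := (fun t => f (2 * t + 0)) : subspace _ -> _)).
      by move=> t /set_mem tI; apply/esym/hf.
    by apply: within_affine_comp cf _ => t; rewrite !in_itv /=; lra.
  apply: (subspace_eq_continuous (f := (fun t => g (2 * t + -1)) : subspace _ -> _)).
    by move=> t /set_mem tI; apply/esym/hg.
  by apply: within_affine_comp cg _ => t; rewrite !in_itv /=; lra.
- move=> t; rewrite in_itv /h /= => t01; case: ifPn => t2.
    by apply: uf; rewrite in_itv /=; lra.
  by apply: ug; rewrite in_itv /=; lra.
- by rewrite hf ?in_itv /= ?mulr0 ?addr0 //; lra.
- by rewrite hg ?in_itv /=; [rewrite mulr1 (_ : 2 + -1 = 1) //; lra|lra].
Qed.

Lemma unitary_homotopic_pad n N (u v : 'M[A]_n) : (n <= N)%N ->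
  unitary_homotopic u v -> unitary_homotopic (pad N u) (pad N v).
Proof.
move=> nN [f [cf uf f0 f1]]; exists (fun t => pad N (f t)); split.
- apply: (@within_continuous_comp _ _ _ _ f (@pad N n)) => // M _.
  move=> U [P PM PU]; pose wd := widen_ord nN.
  exists (fun k l => P (wd k) (wd l)) => [k l|X PX].
    by have := PM (wd k) (wd l); rewrite mxE /= !valK.
  apply: PU => i j; have := PM i j; rewrite !mxE.
  case: insubP => [i' _ ii'|_]; last exact: nbhs_singleton.
  case: insubP => [j' _ jj'|_]; last exact: nbhs_singleton.
  move=> _; have := PX i' j'.
  by rewrite (_ : wd i' = i) 1?(_ : wd j' = j) //; apply: val_inj.
- by move=> t t01; apply: is_unitary_mx_pad => //; exact: uf.
- by rewrite f0.
- by rewrite f1.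
Qed.

Definition unitary_inf := {n : nat & unitary_mx n}.

(* u ~_1 v: diag(u, 1) and diag(v, 1) are homotopic in some U_N(A).            *)
Definition unitary_stable_equiv m n (u : unitary_mx m) (v : unitary_mx n) :
    Prop :=
  exists N, [/\ (m <= N)%N, (n <= N)%N &
    unitary_homotopic (pad N (umx u)) (pad N (umx v))].

Definition k1_rel : rel unitary_inf :=
  fun u v => `[< unitary_stable_equiv (tagged u) (tagged v) >].

Fact k1_rel_equiv : equiv_class_of k1_rel.
Proof.
split=> [[n u]|u v|v u w].
- apply/asboolP; exists n; split=> //=; apply: unitary_homotopic_refl.
  exact/is_unitary_mx_pad/umxP.
- by apply/asboolP/asboolP => -[N [? ? /unitary_homotopic_sym]]; exists N.
- move=> /asboolP[N [uN vN uv]] /asboolP[N' [vN' wN' vw]]; apply/asboolP.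
  have NM : (N <= maxn N N')%N by rewrite leq_maxl.
  have NM' : (N' <= maxn N N')%N by rewrite leq_maxr.
  exists (maxn N N'); split; [exact: leq_trans NM|exact: leq_trans NM'|].
  move: uv => /(unitary_homotopic_pad NM); rewrite !pad_pad // => uv.
  move: vw => /(unitary_homotopic_pad NM'); rewrite !pad_pad // => vw.
  exact: unitary_homotopic_trans uv vw.
Qed.

Canonical k1_equiv_rel := EquivRelPack k1_rel_equiv.

End Unitaries.

Arguments unitary1 {R} A n.

(* K_1(A) = U_oo(A) / ~_1. The group law [u] + [v] = [diag(u, v)], with neutral *)
(* element [1], is not needed: the group is trivial iff [1] is its only point. *)
Definition K1 (R : realType) (A : cstarAlgType R) := {eq_quot @k1_rel R A}.

Section K1Theory.
Variables (R : realType) (A : cstarAlgType R).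

HB.instance Definition _ := Choice.on (K1 A).
HB.instance Definition _ := EqQuotient.on (K1 A).

Definition K1_class n (u : unitary_mx A n) : K1 A :=
  \pi_(K1 A) (Tagged (@unitary_mx R A) u).

Lemma K1_classP m n (u : unitary_mx A m) (v : unitary_mx A n) :
  K1_class u = K1_class v <-> unitary_stable_equiv u v.
Proof. by split=> [/eqmodP/asboolP|uv]; last exact/eqmodP/asboolP. Qed.

Definition K1_trivial : Prop := forall x : K1 A, x = K1_class (unitary1 A 1).

End K1Theory.

Arguments K1_trivial {R} A.

Section Pij.
Variables (R : realType) (A : cstarAlgType R) (n : nat) (i j : 'I_n).

(* P_{i,j}(a), with a *: delta_mx k l standing for a (x) E_{k,l}. That         *)
(* 1 + a a^* is invertible is shown below only for a unitary, where it is 2.   *)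
Definition Pij (a : A) : 'M[A]_n :=
  let b := (1 + a * star a)^-1 in
  b *: delta_mx i i + (b * a) *: delta_mx i j
  + (star a * b) *: delta_mx j i + (star a * b * a) *: delta_mx j j.

Lemma madj_scale_delta (a : A) (k l : 'I_n) :
  madj (a *: delta_mx k l) = star a *: delta_mx l k.
Proof.
apply/matrixP => p q; rewrite !mxE starM.
by rewrite andbC; case: andP => _; rewrite ?star1 ?star0 ?mulr1 ?mul1r ?mulr0 ?mul0r.
Qed.

Lemma mul_scale_delta (a b : A) (k l p q : 'I_n) :
  (a *: delta_mx k l) *m (b *: delta_mx p q)
  = (if l == p then a * b else 0) *: (delta_mx k q : 'M[A]_n).
Proof.
apply/matrixP => r s; rewrite !mxE (bigD1 l) //= big1 => [|t tl]; last first.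
  by rewrite !mxE (negbTE tl) andbF mulr0 mul0r.
rewrite !mxE eqxx andbT addr0.
case: (r == k); case: (l == p); case: (s == q);
  by rewrite /= ?(mulr1, mulr0, mul0r).
Qed.

Lemma is_proj_Pij_unit (a : A) : i != j ->
  1 + a * star a \is a GRing.unit -> is_proj_mx (Pij a).
Proof.
move=> ij ub; have ji : (j == i) = false by rewrite eq_sym (negbTE ij).
rewrite /is_proj_mx /Pij; set b := (1 + _)^-1.
have sb : star b = b by rewrite starV // starD star1 starM starK.
have bb : b * b + b * a * (star a * b) = b.
  by rewrite mulrA -(mulrA b a) -mulrDl -{1}[b]mulr1 -mulrDr mulVr // mul1r.
apply/andP; split; apply/eqP.
  have madjD (M N : 'M[A]_n) : madj (M + N) = madj M + madj N.
    by apply/matrixP => p q; rewrite !mxE starD.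
  rewrite !madjD !madj_scale_delta !starM !starK sb mulrA.
  by rewrite [LHS](ACl (1*3*2*4)).
rewrite !mulmxDl !mulmxDr !mul_scale_delta !eqxx (negbTE ij) ji !scale0r.
rewrite !(addr0, add0r).
have e1 : b * (b * a) + b * a * (star a * b * a) = b * a.
  by rewrite mulrA (mulrA (b * a)) -mulrDl bb.
have e2 : star a * b * b + star a * b * a * (star a * b) = star a * b.
  by rewrite -!(mulrA (star a)) -mulrDr bb.
have e3 : star a * b * (b * a) + star a * b * a * (star a * b * a)
    = star a * b * a.
  by rewrite mulrA (mulrA _ _ a) -mulrDl e2.
rewrite !addrA [LHS](ACl ((1*3)*(2*4)*(5*7)*(6*8))) /=.
by rewrite -!scalerDl bb e1 e2 e3.
Qed.

Lemma unitary_1D_unit (u : A) : unitary u -> 1 + u * star u \is a GRing.unit.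
Proof.
case=> _ ->; apply/unitrP; exists (2^-1%:A).
have -> : 1 + 1 = 2%:A :> A by rewrite -[2]/(1 + 1) scalerDl scale1r.
by rewrite -!scalerAl !mul1r !scalerA mulVf ?mulfV ?scale1r.
Qed.

Fact is_proj_Pij (hij : i != j) (u : A) (hu : unitary u) : is_proj_mx (Pij u).
Proof. exact/is_proj_Pij_unit/unitary_1D_unit. Qed.

Definition proj_Pij (hij : i != j) (u : A) (hu : unitary u) : projector A n :=
  Projector (is_proj_Pij hij hu).

End Pij.

(* Main.v *)
(* The row v = 2^(-1/2) (e_i + u e_j) satisfies star v * v = P_{i,j}(u) and    *)
(* v * star v = (1 + u * star u) / 2 = 1, so P_{i,j}(u) is Murray-von Neumann  *)
(* equivalent to 1, and the two classes already agree in V(A).                 *)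
Require Import Defs.
From HB Require Import structures.
From mathcomp Require Import all_boot all_order all_algebra.
From mathcomp Require Import complex.
From mathcomp Require Import all_classical all_reals all_analysis.

Set Implicit Arguments.
Unset Strict Implicit.
Unset Printing Implicit Defensive.

Import GRing.Theory Num.Theory.

Local Open Scope ring_scope.

Section RankOne.
Variables (R : realType) (A : cstarAlgType R).

(** Unitarity makes 1 + u u^* the scalar 2, so P_{i,j}(u) has rank one over A: it factors as v^* v
    through the 1 x n row v of [Pij_row] ([Pij_row_domain]). That row is a coisometry onto A
    ([Pij_row_range]), so v is the partial isometry linking P_{i,j}(u) to 1. *)

Definition half_sqrt : R[i]%C := sqrtC 2^-1.

Lemma half_sqrt_conj : Num.conj half_sqrt = half_sqrt.
Proof. by rewrite geC0_conj // sqrtC_ge0 invr_ge0 ler0n. Qed.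

Lemma half_sqrtM : half_sqrt * half_sqrt = 2^-1.
Proof. by rewrite -expr2 sqrtCK. Qed.

Lemma invr_1D_unitary (u : A) :
  unitary u -> (1 + u * star u)^-1 = 2^-1%:A.
Proof.
move=> hu; apply: (mulrI (unitary_1D_unit hu)).
rewrite divrr; last exact: unitary_1D_unit.
case: hu => _ ->.
have -> : 1 + 1 = 2%:A :> A by rewrite -[2]/(1 + 1) scalerDl scale1r.
by rewrite -scalerAl mul1r scalerA mulfV ?scale1r // pnatr_eq0.
Qed.

Definition Pij_row n (i j : 'I_n) (u : A) : 'M[A]_(1, n) :=
  \row_k (half_sqrt *: ((k == i)%:R + (k == j)%:R * u)).

Lemma star_nat_bool (b : bool) : star (b%:R : A) = b%:R.
Proof. by case: b; rewrite (star0, star1). Qed.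

Lemma Pij_row_domain n (i j : 'I_n) (u : A) : unitary u ->
  madj (Pij_row i j u) *m Pij_row i j u = Pij i j u.
Proof.
move=> hu; apply/matrixP => p q.
rewrite /Pij invr_1D_unitary // !mxE big_ord1 !mxE.
rewrite starZ half_sqrt_conj -scalerAl -scalerAr scalerA half_sqrtM.
rewrite starD starM !star_nat_bool mulrDl !mulrDr.
rewrite -!scalerAl -!scalerAr -!scalerAl !mulr1 !mul1r -!scalerDr.
case: hu => uu _; rewrite uu !addrA.
congr (_ *: _).
(* Both sides are the same sum over the four matrix units, with u^* u = 1 at E_{j,j}; an entry
   depends only on these four tests. *)
by case: (p == i); case: (p == j); case: (q == i); case: (q == j);
  rewrite /= ?(mulr0, mul0r, addr0, add0r, mulr1, mul1r, uu).
Qed.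

(** As i and j differ, 1 and u sit in distinct columns: no cross terms arise, and the product is (1
    + u u^* ) / 2. *)
Lemma Pij_row_range n (i j : 'I_n) (u : A) : i != j -> unitary u ->
  Pij_row i j u *m madj (Pij_row i j u) = 1%:M.
Proof.
move=> ij [_ uu]; apply/matrixP => p q; rewrite !ord1 !mxE.
have ji : j == i = false by rewrite eq_sym (negbTE ij).
rewrite (bigD1 i) //= (bigD1 j) ?ji //= big1 => [|k /andP[ki kj]]; last first.
  by rewrite !mxE (negbTE ki) (negbTE kj) mul0r addr0 scaler0 mul0r.
rewrite !mxE !eqxx ji (negbTE ij) !(mul0r, addr0, add0r, mul1r).
rewrite !starZ half_sqrt_conj star1 -!scalerAl -!scalerAr !scalerA uu mulr1.
by rewrite half_sqrtM -scalerDl -[2^-1]mul1r -splitr scale1r.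
Qed.

End RankOne.

Theorem theorem5p4 (R : realType) (A : cstarAlgType R)
    (hsimple : cstar_simple A) (hpi : purely_infinite A)
    (hK1 : K1_trivial A) (n : nat) (hn : (2 <= n)%N) (i j : 'I_n)
    (hij : i != j) (u : A) (hu : unitary u) :
  K0_class (proj_Pij hij hu) = K0_class (proj1 A 1).
Proof.
(* Both formal differences subtract 0, so equality in V(A) suffices. *)
congr (gdiff _ _); apply/mvn_classP; exists (Pij_row i j u); split.
  exact: Pij_row_domain.
exact: Pij_row_range.
Qed.
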